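(* Let $g\neq0$ be a special Bernstein function. Then \[\frac{1}{3e}\,|g(z)|\le g(|z|)\le 3e\,|g(z)|\] for all $z\in\mathbb C$ with $\operatorname{Re}z\ge0$.
   Context: A Bernstein function is $g(z)=a+bz+\int_{(0,\infty)}(1-e^{-sz})\mu(\mathrm ds)$ with $a,b\ge0$ and $\mu$ a positive Radon measure on $(0,\infty)$ with $\int\frac{s}{1+s}\mu(\mathrm ds)<\infty$; it is identified with its holomorphic extension to $\{\operatorname{Re}z>0\}$ given by this formula, which extends continuously to $\{\operatorname{Re}z\ge0\}$. A Bernstein function $g\ne0$ is special if $z\mapsto z/g(z)$ is again a Bernstein function. *)

(* Defs.v *)
From HB Require Import structures.
From mathcomp Require Import all_boot all_order all_algebra.
From mathcomp Require Import all_classical all_reals all_analysis.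
Set Implicit Arguments. Unset Strict Implicit. Unset Printing Implicit Defensive.
Import Order.TTheory GRing.Theory Num.Theory.
Import numFieldNormedType.Exports.
Local Open Scope classical_set_scope.
Local Open Scope ring_scope.

(* A Bernstein function g(z) = a + b z + \int_{(0,oo)} (1 - e^{-sz}) mu(ds)
   is encoded by its data (a, b, mu); mu is a (positive) measure on the
   Borel sets of R of which only the restriction to (0,oo) is used.
   For z = x + i y with x >= 0 we write out the real and imaginary parts. *)

Definition bernstein_data (R : realType) (a b : R)
  (mu : {measure set R -> \bar R}) : Prop :=
  0 <= a /\ 0 <= b /\
  (\int[mu]_(s in `]0%R, +oo[) ((s / (1 + s))%:E) < +oo)%E.

Definition bern_re (R : realType) (a b : R) (mu : {measure set R -> \bar R})
  (x y : R) : R :=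
  a + b * x + Rintegral mu `]0%R, +oo[ (fun s => 1 - expR (- (s * x)) * cos (s * y)).

Definition bern_im (R : realType) (a b : R) (mu : {measure set R -> \bar R})
  (x y : R) : R :=
  b * y + Rintegral mu `]0%R, +oo[ (fun s => expR (- (s * x)) * sin (s * y)).

Definition bern_abs (R : realType) (a b : R) (mu : {measure set R -> \bar R})
  (x y : R) : R :=
  Num.sqrt (bern_re a b mu x y ^+ 2 + bern_im a b mu x y ^+ 2).

Definition bern_nonzero (R : realType) (a b : R)
  (mu : {measure set R -> \bar R}) : Prop :=
  exists x y : R, 0 <= x /\ (bern_re a b mu x y != 0 \/ bern_im a b mu x y != 0).

Definition bern_special (R : realType) (a b : R)
  (mu : {measure set R -> \bar R}) : Prop :=
  exists (a' b' : R) (nu : {measure set R -> \bar R}),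
    bernstein_data a' b' nu /\
    forall x : R, 0 < x -> x / bern_re a b mu x 0 = bern_re a' b' nu x 0.

(* Main.v *)
Require Import Defs.
From HB Require Import structures.
From mathcomp Require Import all_boot all_order all_algebra.
From mathcomp Require Import all_classical all_reals all_analysis.
From mathcomp Require Import measurable_realfun complex ring lra.
Set Implicit Arguments. Unset Strict Implicit. Unset Printing Implicit Defensive.
Import Order.TTheory GRing.Theory Num.Theory.
Import numFieldNormedType.Exports.
Local Open Scope classical_set_scope.
Local Open Scope complex_scope.
Local Open Scope ring_scope.

(* For [Re z >= 0] the pointwise bound [|1 - e^{-sz}| <= C (1 - e^{-s|z|})]
   integrates to [|g(z)| <= C g(|z|)] for every Bernstein function [g].  When [g]
   is special, the same bound for the conjugate function [f(z) = z / g(z)] reads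
   [|z| / |g(z)| <= C |z| / g(|z|)], which is the reverse inequality.

   This needs [g(z) f(z) = z] off the real axis.  Expanding [e^{-sz}] around a
   real point [c], both [g] and [f] are sums of power series on the disc of
   radius [c] about [c], so the identity passes from the reals to that disc, and
   every [z] with [Re z > 0] lies in such a disc for [c] large.  The imaginary
   axis follows by dominated convergence. *)

(** * Quantitative Taylor approximation *)

(** The Wiener-type norm of absolutely convergent power series on the disc of radius [rho]: it
    dominates the sup norm there and is submultiplicative. Working over a [numFieldType] allows [K]
    to be [R[i]]. *)
Definition l1norm (K : numFieldType) (rho : K) (p : {poly K}) : K :=
  \sum_(i < size p) `|p`_i| * rho ^+ i.

Lemma l1norm_wide (K : numFieldType) (rho : K) (p : {poly K}) (n : nat) :
  (size p <= n)%N -> l1norm rho p = \sum_(i < n) `|p`_i| * rho ^+ i.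
Proof.
move=> le_n; rewrite /l1norm (big_ord_widen n (fun i => `|p`_i| * rho ^+ i)) //.
rewrite big_mkcond; apply: eq_bigr => i _; case: ltnP => // le_i.
by rewrite nth_default // normr0 mul0r.
Qed.

Lemma l1norm_ge0 (K : numFieldType) (rho : K) (p : {poly K}) :
  0 <= rho -> 0 <= l1norm rho p.
Proof. by move=> h; apply: sumr_ge0 => i _; rewrite mulr_ge0 ?exprn_ge0. Qed.

Lemma l1norm0 (K : numFieldType) (rho : K) : l1norm rho 0 = 0.
Proof. by rewrite /l1norm size_poly0 big_ord0. Qed.

Lemma l1normD (K : numFieldType) (rho : K) (p q : {poly K}) :
  0 <= rho -> l1norm rho (p + q) <= l1norm rho p + l1norm rho q.
Proof.
move=> h; set n := maxn (size p) (size q).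
rewrite (@l1norm_wide _ _ (p + q) n) ?size_polyD //.
rewrite (@l1norm_wide _ _ p n) ?leq_maxl // (@l1norm_wide _ _ q n) ?leq_maxr //.
rewrite -big_split /=; apply: ler_sum => i _.
by rewrite coefD -mulrDl ler_wpM2r ?exprn_ge0 ?ler_normD.
Qed.

Lemma l1norm_cons (K : numFieldType) (rho : K) (p : {poly K}) (c : K) :
  l1norm rho (p * 'X + c%:P) = l1norm rho p * rho + `|c|.
Proof.
rewrite (@l1norm_wide _ _ _ (size p).+1); last first.
  rewrite -cons_poly_def size_cons_poly; by case: ifP.
rewrite big_ord_recl /= expr0 mulr1 coefD coefMX coefC /= add0r addrC; congr (_ + _).
rewrite /l1norm mulr_suml; apply: eq_bigr => i _.
by rewrite /bump /= add1n coefD coefMX coefC /= addr0 exprSr mulrA.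
Qed.

Lemma l1normMX (K : numFieldType) (rho : K) (p : {poly K}) :
  l1norm rho (p * 'X) = l1norm rho p * rho.
Proof. by rewrite -[p * 'X]addr0 -[X in _ + X]polyC0 l1norm_cons normr0 addr0. Qed.

Lemma l1normC (K : numFieldType) (rho c : K) : l1norm rho c%:P = `|c|.
Proof. by rewrite -[c%:P]add0r -(mul0r 'X) l1norm_cons l1norm0 mul0r add0r. Qed.

Lemma l1norm_scale (K : numFieldType) (rho c : K) (p : {poly K}) :
  l1norm rho (c%:P * p) = `|c| * l1norm rho p.
Proof.
rewrite (@l1norm_wide _ _ _ (size p)) ?mul_polyC ?size_scale_leq //.
rewrite /l1norm mulr_sumr; apply: eq_bigr => i _.
by rewrite coefZ normrM mulrA.
Qed.

Lemma l1normM (K : numFieldType) (rho : K) (p q : {poly K}) :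
  0 <= rho -> l1norm rho (p * q) <= l1norm rho p * l1norm rho q.
Proof.
move=> h; elim/poly_ind: p => [|p c IH]; first by rewrite mul0r l1norm0 mul0r.
rewrite mulrDl -mulrA -commr_polyX mulrA (le_trans (l1normD _ _ _)) //.
rewrite l1norm_scale l1normMX.
by rewrite l1norm_cons mulrDl lerD2r mulrAC ler_wpM2r.
Qed.

(** All terms are nonnegative when [rho] is, so both the truncation and the cut-off tail of a
    polynomial inherit a bound on its norm. *)
Lemma l1norm_take_drop (K : numFieldType) (rho : K) (p : {poly K}) (n : nat) :
  l1norm rho p = l1norm rho (take_poly n p) + rho ^+ n * l1norm rho (drop_poly n p).
Proof.
rewrite (@l1norm_wide _ _ p (n + size p)) ?leq_addl // big_split_ord /=.
rewrite (@l1norm_wide _ _ _ n) ?size_take_poly //.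
rewrite (@l1norm_wide _ _ (drop_poly n p) (size p)) ?size_drop_poly ?leq_subr //.
congr (_ + _); first by apply: eq_bigr => i _; rewrite coef_take_poly ltn_ord.
rewrite mulr_sumr; apply: eq_bigr => i _.
by rewrite coef_drop_poly /= [(i + n)%N]addnC exprD mulrCA.
Qed.

Lemma norm_horner_le (K : numFieldType) (rho w : K) (p : {poly K}) :
  `|w| <= rho -> `|p.[w]| <= l1norm rho p.
Proof.
move=> h; rewrite horner_coef (le_trans (ler_norm_sum _ _ _)) //.
apply: ler_sum => i _; rewrite normrM normrX ler_wpM2l //.
by rewrite lerXn2r ?nnegrE ?(le_trans _ h).
Qed.

(* A quantitative form of "[G] is the sum of a power series on the closed disc
   of radius [rho]" that never mentions an infinite sum. *)
Definition taylor_approx (K : numFieldType) (rho : K) (G : K -> K) : Prop :=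
  exists2 M : K, 0 <= M & forall N : nat, exists p : {poly K},
    [/\ (size p <= N.+1)%N, l1norm rho p <= M &
        forall w, `|w| <= rho -> `|G w - p.[w]| <= M * (`|w| / rho) ^+ N.+1].

(** The product of two approximants has too high a degree, so it is truncated. What is cut off is
    divisible by ['X^N.+1], and its cofactor is controlled by submultiplicativity of the norm. *)
Lemma taylor_approxM (K : numFieldType) (rho : K) (F G : K -> K) : 0 < rho ->
  taylor_approx rho F -> taylor_approx rho G -> taylor_approx rho (fun w => F w * G w).
Proof.
move=> rho0 [M M0 hF] [L L0 hG]; have rho_ge0 := ltW rho0.
exists (4 * (M * L)) => [|N]; first by rewrite mulr_ge0 ?mulr_ge0.
have [p [sp np ep]] := hF N; have [q [sq nq eq]] := hG N.
have ML0 : 0 <= M * L by rewrite mulr_ge0.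
have npq : l1norm rho (p * q) <= M * L.
  by rewrite (le_trans (l1normM _ _ _)) // ler_pM ?l1norm_ge0.
have td := l1norm_take_drop rho (p * q) N.+1.
have le4 : M * L <= 4 * (M * L) by rewrite ler_peMl // ler1n.
exists (take_poly N.+1 (p * q)); split; first exact: size_take_poly.
- apply: le_trans le4; apply: le_trans npq.
  by rewrite td lerDl mulr_ge0 ?exprn_ge0 ?l1norm_ge0.
- move=> w hw; set t := _ ^+ N.+1.
  have t0 : 0 <= t by rewrite exprn_ge0 // divr_ge0.
  have t1 : t <= 1 by rewrite exprn_ile1 ?divr_ge0 // ler_pdivrMr // mul1r.
  have hp : `|p.[w]| <= M by rewrite (le_trans (norm_horner_le _ hw)).
  have hG2 : `|G w| <= 2 * L.
    rewrite -[G w](subrK q.[w]) (le_trans (ler_normD _ _)) // mulr_natl mulr2n.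
    rewrite lerD ?(le_trans (norm_horner_le _ hw)) // (le_trans (eq _ hw)) //.
    by rewrite ler_piMr.
  have tail : `|(p * q).[w] - (take_poly N.+1 (p * q)).[w]| <= M * L * t.
    rewrite -{1}(poly_take_drop N.+1 (p * q)) hornerD addrC addKr hornerM hornerXn.
    have rt : `|w ^+ N.+1| = rho ^+ N.+1 * t.
      by rewrite /t expr_div_n normrX mulrCA mulfV ?mulr1 // expf_neq0 // gt_eqF.
    rewrite normrM rt mulrA ler_wpM2r //; apply: le_trans npq.
    rewrite td mulrC ler_wpDl ?l1norm_ge0 // ler_wpM2l ?exprn_ge0 //.
    exact: norm_horner_le.
  rewrite -[F w * G w](subrK (p * q).[w]) -addrA (le_trans (ler_normD _ _)) //.
  (* The constant 4 collects three errors: 2 from (F - p) G, where |G| <= 2 L; 1 from p (G - q); and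
     1 from the truncation. *)
  have -> : 4 * (M * L) * t = 2 * (M * L * t) + M * L * t + M * L * t by ring.
  rewrite -addrA [leRHS]addrA [leRHS]addrC [leRHS]addrC -addrA [leRHS]addrA lerD //.
  have -> : F w * G w - (p * q).[w] = (F w - p.[w]) * G w + p.[w] * (G w - q.[w]).
    by rewrite hornerM; ring.
  rewrite (le_trans (ler_normD _ _)) // !normrM lerD //.
    have -> : 2 * (M * L * t) = M * t * (2 * L) by ring.
    by rewrite ler_pM ?ep.
  by rewrite -mulrA ler_pM // eq.
Qed.

Lemma taylor_approxN (K : numFieldType) (rho : K) (F : K -> K) :
  taylor_approx rho F -> taylor_approx rho (fun w => - F w).
Proof.
move=> [M M0 hF]; exists M => // N; have [p [sp np ep]] := hF N.
exists (- p); split; first by rewrite size_polyN.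
  rewrite /l1norm size_polyN; under eq_bigr do rewrite coefN normrN; exact: np.
by move=> w /ep; rewrite hornerN -opprD normrN.
Qed.

Lemma taylor_approxD (K : numFieldType) (rho : K) (F G : K -> K) : 0 <= rho ->
  taylor_approx rho F -> taylor_approx rho G -> taylor_approx rho (fun w => F w + G w).
Proof.
move=> rho0 [M M0 hF] [L L0 hG]; exists (M + L) => [|N]; first exact: addr_ge0.
have [p [sp np ep]] := hF N; have [q [sq nq eq]] := hG N.
exists (p + q); split; first by rewrite (leq_trans (size_polyD _ _)) // geq_max sp.
  by rewrite (le_trans (l1normD _ _ _)) // lerD.
move=> w hw; rewrite hornerD mulrDl.
have -> : F w + G w - (p.[w] + q.[w]) = (F w - p.[w]) + (G w - q.[w]) by ring.
by rewrite (le_trans (ler_normD _ _)) // lerD ?ep ?eq.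
Qed.

Lemma taylor_approx_linear (K : numFieldType) (rho c d : K) : 0 < rho ->
  taylor_approx rho (fun w => c + d * w).
Proof.
move=> rho0; have rho_ge0 := ltW rho0.
have h : 0 <= `|c| + `|d| * rho by rewrite addr_ge0 // mulr_ge0.
(* For order 0 only a constant meets the degree bound, and the linear term becomes the error: |d w|
   = |d| rho (|w| / rho). From order 1 on the approximation is exact. *)
exists (`|c| + `|d| * rho) => // -[|N].
  exists c%:P; split; rewrite ?size_polyC_leq1 //.
    by rewrite l1normC lerDl mulr_ge0.
  move=> w hw; rewrite hornerC addrC addKr expr1 mulrDl -mulrA [rho * _]mulrCA.
  by rewrite mulfV ?gt_eqF // mulr1 normrM lerDr mulr_ge0 // divr_ge0.
exists (d%:P * 'X + c%:P); split.
- rewrite -cons_poly_def size_cons_poly; case: ifP => // _.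
  by rewrite ltnS (leq_trans (size_polyC_leq1 _)).
- by rewrite l1norm_cons addrC l1normC.
- move=> w hw; rewrite hornerD hornerM !hornerC hornerX [_ + c]addrC subrr normr0.
  by rewrite mulr_ge0 // exprn_ge0 // divr_ge0.
Qed.

(** A polynomial of degree below N that is O(t^N) at 0+ vanishes: its constant term is O(t), hence
    0, and dividing by ['X] lowers both the degree and the order. *)
Lemma poly_small_eq0 (K : numFieldType) (rho C : K) (N : nat) (p : {poly K}) :
  0 < rho -> (size p <= N)%N ->
  (forall t, 0 < t < rho -> `|p.[t]| <= C * t ^+ N) -> p = 0.
Proof.
move=> rho0; elim: N p => [|N IH] p; first by move=> /size_poly_leq0P.
elim/poly_ind: p => [//|p c _] sp hp; have rho_ge0 := ltW rho0.
have C0 : 0 <= C.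
  have /hp/(le_trans (normr_ge0 _)) : 0 < rho / 2 < rho.
    by rewrite divr_gt0 //= ltr_pdivrMr // ltr_pMr // ltr1n.
  by rewrite pmulr_lge0 // exprn_gt0 // divr_gt0.
pose D := C * rho ^+ N + l1norm rho p.
have D0 : 0 <= D by rewrite addr_ge0 ?mulr_ge0 ?exprn_ge0 ?l1norm_ge0.
have c_le t : 0 < t < rho -> `|c| <= D * t.
  move=> /[dup] ht /andP[t0 tr]; have := hp t ht; rewrite hornerD hornerM hornerX hornerC.
  have tr' : `|t| <= rho by rewrite gtr0_norm // ltW.
  rewrite -[c in _ -> `|c| <= _](addKr (p.[t] * t)) => h.
  rewrite (le_trans (ler_normD _ _)) // addrC mulrDl lerD //.
    rewrite (le_trans h) // exprSr mulrA ler_wpM2r ?(ltW t0) // ler_wpM2l //.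
    by rewrite lerXn2r ?nnegrE ?(ltW t0) ?(ltW tr).
  by rewrite normrN normrM (gtr0_norm t0) ler_wpM2r ?(ltW t0) ?norm_horner_le.
have c0 : c = 0.
  (* A nonzero [c] is refuted at the explicit point t = rho |c| / E. There D t = |c| (D rho / E) <
     |c|, against |c| <= D t. *)
  apply/eqP; apply: contraT => c0; pose E := 2 * (`|c| + D * rho).
  have cp : 0 < `|c| by rewrite normr_gt0.
  have E0 : 0 < E by rewrite mulr_gt0 // ltr_wpDr // mulr_ge0.
  have /c_le : 0 < rho * (`|c| / E) < rho.
    rewrite mulr_gt0 ?divr_gt0 //= gtr_pMr // ltr_pdivrMr // mul1r /E mulrDr.
    by rewrite ltr_wpDr ?mulr_ge0 // ltr_pMl // ltr1n.
  have -> : D * (rho * (`|c| / E)) = `|c| * (D * rho / E) by ring.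
  rewrite ler_pMr // ler_pdivlMr // mul1r /E => h.
  have : D * rho < 2 * (`|c| + D * rho).
    by rewrite mulr_natl mulr2n ltr_wpDr ?ltr_pwDl // ?addr_ge0 ?mulr_ge0.
  by move=> /(le_lt_trans h); rewrite ltxx.
move: sp hp; rewrite c0 addr0 => sp hp.
rewrite (IH p) ?mul0r //.
  by move: sp; have [->|p0] := eqVneq p 0; rewrite ?size_poly0 // size_mulX.
move=> t /[dup] ht /andP[t0 _]; have := hp t ht.
by rewrite hornerM hornerX normrM (gtr0_norm t0) exprSr mulrA ler_pM2r.
Qed.

(** An identity theorem: where [G] vanishes, the error bound says that the approximant of order N is
    O(t^(N+1)), so it is the zero polynomial, and the error bound becomes a bound on [G] itself over
    the whole disc. *)
Lemma taylor_approx_eq0 (K : numFieldType) (rho : K) (G : K -> K) : 0 < rho ->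
  taylor_approx rho G -> (forall t, 0 < t < rho -> G t = 0) ->
  exists2 M : K, 0 <= M &
    forall N w, `|w| <= rho -> `|G w| <= M * (`|w| / rho) ^+ N.+1.
Proof.
move=> rho0 [M M0 hG] G0; exists M => // N w hw; have [p [sp np ep]] := hG N.
suff p0 : p = 0 by have := ep w hw; rewrite p0 horner0 subr0.
apply: (@poly_small_eq0 _ rho (M / rho ^+ N.+1) N.+1) => // t /[dup] ht /andP[t0 tr].
have := ep t; rewrite (gtr0_norm t0) (ltW tr) G0 // sub0r normrN => /(_ isT).
by rewrite expr_div_n [t ^+ _ / _]mulrC mulrA.
Qed.

(** * Taylor remainder of the complex exponential *)

Lemma ge0_of_derive_ge0 (R : realType) (f df : R -> R) :
  (forall x : R, is_derive x 1 f (df x)) -> (forall x, 0 <= x -> 0 <= df x) ->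
  0 <= f 0 -> forall x, 0 <= x -> 0 <= f x.
Proof.
move=> fd df0 f0 x x0; apply: le_trans f0 _.
apply: (@ger0_derive1_ndecry _ f 0) => //.
- by move=> y; rewrite in_itv/= andbT => y0; rewrite derive1E (@derive_val _ _ _ _ _ _ _ (fd y)) df0 // ltW.
- by apply: derivable_within_continuous => y _; exact: ex_derive.
Qed.

(** A partial sum of the exponential generating function of [c]. In this form differentiation shifts
    [c] and drops one term. *)
Definition egf_sum (R : realType) (c : nat -> R) (N : nat) (x : R) : R :=
  \sum_(k < N) c k * (x ^+ k / k`!%:R).

Lemma is_derive_egf_sum (R : realType) (c : nat -> R) (N : nat) (x : R) :
  is_derive x 1 (egf_sum c N.+1) (egf_sum (c \o succn) N x).
Proof.
have -> : egf_sum c N.+1 = \sum_(k < N.+1) (fun x => c k * (x ^+ k / k`!%:R)).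
  by apply/funext => y; rewrite fct_sumE.
have -> : egf_sum (c \o succn) N x =
    \sum_(k < N.+1) (c k / k`!%:R * (k%:R * x ^+ k.-1)).
  rewrite big_ord_recl /= mul0r mulr0 add0r; apply: eq_bigr => k _ /=.
  have k0 : k.+1%:R != 0 :> R by rewrite pnatr_eq0.
  rewrite /bump/= add1n factS natrM invfM -mulrA; congr (_ * _).
  by rewrite mulrACA mulVf // mul1r mulrC.
apply: is_derive_sum => k.
have -> : (fun x : R => c k * (x ^+ k / k`!%:R)) = (c k / k`!%:R) *: (id ^+ k).
  by apply/funext => y; rewrite fctE /GRing.scale /= [RHS]mulrAC mulrA.
apply: is_derive_eq.
by rewrite /GRing.scale/= mulr1 mulr_natl.
Qed.

Lemma egf_sum0 (R : realType) (c : nat -> R) (N : nat) : egf_sum c N.+1 0 = c 0%N.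
Proof.
rewrite /egf_sum big_ord_recl /= expr0 divr1 mulr1 big1 ?addr0 // => k _.
by rewrite expr0n /= mul0r mulr0.
Qed.

Definition exp_rem (R : realType) (N : nat) (x : R) : R := expR x - egf_sum (fun=> 1) N x.

(* The [N]-th Taylor remainder of [Re (e^{i theta} exp (x e^{i alpha}))]: shifting
   [theta] makes this real family closed under differentiation. *)
Definition cis_rem (R : realType) (theta alpha : R) (N : nat) (x : R) : R :=
  expR (x * cos alpha) * cos (x * sin alpha + theta)
  - egf_sum (fun k => cos (theta + k%:R * alpha)) N x.

Lemma is_derive_exp_rem (R : realType) (N : nat) (x : R) :
  is_derive x 1 (exp_rem N.+1) (exp_rem N x).
Proof. by have ? := is_derive_egf_sum (fun=> 1) N x; apply: is_deriveB. Qed.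

Lemma is_derive_cis_rem (R : realType) (theta alpha : R) (N : nat) (x : R) :
  is_derive x 1 (cis_rem theta alpha N.+1) (cis_rem (theta + alpha) alpha N x).
Proof.
have ? := is_derive_egf_sum (fun k => cos (theta + k%:R * alpha)) N x.
have -> : cis_rem theta alpha N.+1 =
   (expR \o (fun x => x * cos alpha)) * (cos \o (fun x => x * sin alpha + theta)) -
   egf_sum (fun k => cos (theta + k%:R * alpha)) N.+1 by [].
apply: is_derive_eq.
have -> : egf_sum ((fun k => cos (theta + k%:R * alpha)) \o succn) N x =
    egf_sum (fun k => cos (theta + alpha + k%:R * alpha)) N x.
  by apply: eq_bigr => k _ /=; congr (cos _ * _); rewrite mulrSr; ring.
rewrite /cis_rem /= /GRing.scale /= addrA [cos (_ + alpha)]cosD.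
by ring.
Qed.

Lemma exp_rem0 (R : realType) (N : nat) : exp_rem N.+1 0 = 0 :> R.
Proof. by rewrite /exp_rem egf_sum0 expR0 subrr. Qed.

Lemma cis_rem0 (R : realType) (theta alpha : R) (N : nat) : cis_rem theta alpha N.+1 0 = 0.
Proof. by rewrite /cis_rem egf_sum0 !mul0r add0r addr0 expR0 mul1r subrr. Qed.

(** Induction on N: the derivatives of [exp_rem] plus or minus [cis_rem] are the same combinations
    one order lower, with [theta] shifted, and all remainders of positive order vanish at 0. This is
    why [theta] is generalized in the induction. *)
Lemma norm_cis_rem_le (R : realType) (theta alpha : R) (N : nat) (x : R) : 0 <= x ->
  `|cis_rem theta alpha N x| <= exp_rem N x.
Proof.
elim: N theta x => [|N IH] theta x x0.
  rewrite /cis_rem /exp_rem /egf_sum !big_ord0 !subr0 normrM ger0_norm ?expR_ge0 //.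
  rewrite -[leRHS]mulr1 ler_pM ?expR_ge0 //.
    by rewrite ler_expR ler_piMr // cos_le1.
  by rewrite ler_norml cos_geN1 cos_le1.
rewrite ler_norml; apply/andP; split.
  rewrite -subr_ge0 opprK.
  have d (y : R) := is_derive_cis_rem theta alpha N y.
  have e (y : R) := is_derive_exp_rem N y.
  apply: (@ge0_of_derive_ge0 _ (cis_rem theta alpha N.+1 + exp_rem N.+1)
    (fun y => cis_rem (theta + alpha) alpha N y + exp_rem N y)) => //.
  - move=> y y0; have := IH (theta + alpha) y y0; rewrite ler_norml => /andP[+ _].
    by rewrite -subr_ge0 opprK.
  - by rewrite fctE cis_rem0 exp_rem0 addr0.
rewrite -subr_ge0.
have d (y : R) := is_derive_cis_rem theta alpha N y.
have e (y : R) := is_derive_exp_rem N y.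
apply: (@ge0_of_derive_ge0 _ (exp_rem N.+1 - cis_rem theta alpha N.+1)
  (fun y => exp_rem N y - cis_rem (theta + alpha) alpha N y)) => //.
- move=> y y0; have := IH (theta + alpha) y y0; rewrite ler_norml => /andP[_].
  by rewrite -subr_ge0.
- by rewrite !fctE cis_rem0 exp_rem0 subrr.
Qed.

Lemma exp_rem_ge0 (R : realType) (N : nat) (x : R) : 0 <= x -> 0 <= exp_rem N x.
Proof. by move=> /(@norm_cis_rem_le R 0 0 N)/(le_trans _)->. Qed.

(** The remainder is the sum of x^k / k! over k >= N, so each term gains a factor q^k <= q^N. The
    proof compares derivatives instead of summing the series. *)
Lemma exp_rem_scale (R : realType) (N : nat) (q x : R) : 0 <= q <= 1 -> 0 <= x ->
  exp_rem N (q * x) <= q ^+ N * exp_rem N x.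
Proof.
move=> /andP[q0 q1]; elim: N x => [|N IH] x x0.
  by rewrite mul1r /exp_rem /egf_sum !big_ord0 !subr0 ler_expR ler_piMl.
rewrite -subr_ge0.
apply: (@ge0_of_derive_ge0 _ (q ^+ N.+1 *: exp_rem N.+1 - (exp_rem N.+1 \o *%R q))
  (fun y => q ^+ N.+1 * exp_rem N y - q * exp_rem N (q * y))) => //.
- move=> y; have e1 := is_derive_exp_rem N y; have e2 := is_derive_exp_rem N (q * y).
  have e3 : is_derive y 1 ( *%R q) q.
    have -> : *%R q = q *: id :> (R -> R) by [].
    by apply: is_derive_eq; rewrite /GRing.scale /= mulr1.
  by apply: is_derive_eq; rewrite /GRing.scale /= [q * _ in RHS]mulrC.
- by move=> y y0; rewrite subr_ge0 exprS -mulrA ler_wpM2l // IH.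
- by rewrite !fctE /GRing.scale /= mulr0 exp_rem0 mulr0 subrr.
Qed.

Lemma exp_rem_le (R : realType) (N : nat) (x : R) : 0 <= x ->
  exp_rem N.+1 x <= expR x - 1.
Proof.
move=> x0; rewrite lerD2l lerN2 /egf_sum big_ord_recl /= mul1r expr0 divr1 lerDl.
by apply: sumr_ge0 => k _; rewrite mul1r divr_ge0 ?exprn_ge0.
Qed.

(** * Pointwise bound on 1 - e^{-sz} in the right half-plane *)

(** The angle is that of z = - r e^{-i beta}, so that -sz = s r e^{-i beta} and e^{-sz} has the form
    expanded in [cis_rem]. The condition Re z >= 0 then reads cos beta <= 0 when r > 0. *)
Lemma polar_coordinates (R : realType) (x y : R) :
  exists beta, x = - (Num.sqrt (x ^+ 2 + y ^+ 2) * cos beta) /\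
               y = Num.sqrt (x ^+ 2 + y ^+ 2) * sin beta.
Proof.
set r := Num.sqrt _.
have r2 : r ^+ 2 = x ^+ 2 + y ^+ 2 by rewrite sqr_sqrtr // addr_ge0 ?sqr_ge0.
have r0 : 0 <= r := sqrtr_ge0 _.
have [r_eq0|rN0] := eqVneq r 0.
  exists 0; rewrite r_eq0 !mul0r oppr0.
  have /eqP : x ^+ 2 + y ^+ 2 = 0 by rewrite -r2 r_eq0 expr0n.
  by rewrite paddr_eq0 ?sqr_ge0 // !sqrf_eq0 => /andP[/eqP -> /eqP ->].
have rp : 0 < r by rewrite lt_neqAle eq_sym rN0.
have bnd : -1 <= - x / r <= 1.
  rewrite -ler_norml normrM normrN normfV (ger0_norm r0) ler_pdivrMr // mul1r.
  by rewrite -ler_sqr ?nnegrE // r2 -normrX ger0_norm ?sqr_ge0 // lerDl sqr_ge0.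
have c : cos (acos (- x / r)) = - x / r by rewrite acosK // in_itv.
have s : sin (acos (- x / r)) = `|y| / r.
  rewrite sin_acos //; have -> : 1 - (- x / r) ^+ 2 = (`|y| / r) ^+ 2.
    rewrite !expr_div_n sqrrN -normrX (ger0_norm (sqr_ge0 _)).
    by rewrite -[y ^+ 2](addrK (x ^+ 2)) [y ^+ 2 + _]addrC -r2 mulrBl mulfV ?expf_neq0.
  by rewrite sqrtr_sqr ger0_norm // divr_ge0.
have [y0|y0] := leP 0 y.
  by exists (acos (- x / r)); rewrite c s ger0_norm //; split; field.
exists (- acos (- x / r)); rewrite cosN sinN c s ltr0_norm //; split; field => //.
Qed.

Lemma expR1_le4 (R : realType) : expR 1 <= 4 :> R.
Proof.
have h : 1 / 2 <= expR (- (1 / 2)) :> R.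
  by apply: le_trans (expR_ge1Dx _); lra.
have e : expR 1 * (expR (- (1 / 2)) * expR (- (1 / 2))) = 1 :> R.
  by rewrite -!expRD -[RHS]expR0; congr expR; field.
have h2 : 1 / 4 <= expR (- (1 / 2)) * expR (- (1 / 2)) :> R by nra.
have := ler_wpM2l (expR_ge0 (1 : R)) h2; rewrite e; lra.
Qed.

(** For t <= 1 the remainder of order 1 gives e^t - 1 = e^t (1 - e^{-t}), and e^t <= e <= 4. For t >
    1 the left side is at most 2, while 1 - e^{-t} >= 1/2 because e^t >= 1 + t. *)
Lemma norm_cis_sub_le (R : realType) (theta beta t : R) : cos beta <= 0 -> 0 <= t ->
  `|cos theta - expR (t * cos beta) * cos (t * sin beta + theta)| <= 4 * (1 - expR (- t)).
Proof.
move=> cb t0; have [t1|t1] := leP t 1.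
  have := norm_cis_rem_le theta beta 1 t0.
  rewrite /cis_rem /exp_rem /egf_sum !big_ord1 expr0 divr1 !mulr1 mul0r addr0 distrC.
  move=> /le_trans; apply.
  have e : expR t * expR (- t) = 1 by rewrite -expRD subrr expR0.
  have h : expR t <= 4 by apply: le_trans (expR1_le4 R); rewrite ler_expR.
  have := expR_ge0 (- t); have : expR (- t) <= 1 by rewrite -[leRHS]expR0 ler_expR oppr_le0.
  nra.
have h1 : expR (t * cos beta) <= 1 by rewrite -[leRHS]expR0 ler_expR mulr_ge0_le0.
have h2 : expR (- t) <= 1 / 2.
  have e : expR t * expR (- t) = 1 by rewrite -expRD subrr expR0.
  by have := expR_ge1Dx t; have := expR_ge0 (- t); nra.
rewrite (le_trans (ler_normB _ _)) // normrM ger0_norm ?expR_ge0 //.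
have n1 : `|cos theta| <= 1 by rewrite ler_norml cos_geN1 cos_le1.
have n2 : `|cos (t * sin beta + theta)| <= 1 by rewrite ler_norml cos_geN1 cos_le1.
have : expR (t * cos beta) * `|cos (t * sin beta + theta)| <= 1 by rewrite mulr_ile1 ?expR_ge0.
lra.
Qed.

(* With [z = x + i y], [theta = 0] gives the real part of [1 - e^{-sz}] and
   [theta = pi / 2] its imaginary part. *)
Definition cis_kernel (R : realType) (theta x y s : R) : R :=
  cos theta - expR (- (s * x)) * cos (s * y + theta).

Lemma norm_cis_kernel_le (R : realType) (theta x y s : R) : 0 <= x -> 0 <= s ->
  `|cis_kernel theta x y s| <= 4 * (1 - expR (- (s * Num.sqrt (x ^+ 2 + y ^+ 2)))).
Proof.
move=> x0 s0; have [beta []] := polar_coordinates x y; set r := Num.sqrt _.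
have r0 : 0 <= r := sqrtr_ge0 _.
have [->|rN0] := eqVneq r 0.
  rewrite !mul0r oppr0 => -> ->.
  by rewrite /cis_kernel !mulr0 add0r oppr0 expR0 mul1r !subrr normr0 mulr0.
have rp : 0 < r by rewrite lt_neqAle eq_sym rN0.
move=> xE yE; have cb : cos beta <= 0.
  by move: x0; rewrite xE -mulrN pmulr_rge0 // oppr_ge0.
have := norm_cis_sub_le theta cb (mulr_ge0 s0 r0).
by rewrite /cis_kernel xE yE mulrN opprK !mulrA.
Qed.

(** Since 1 - e^{-sx} is at most both s x and 1, its product with 1 + s is at most s x + s. This
    ties every kernel to the weight s / (1 + s) of the Levy condition. *)
Lemma one_sub_expR_le (R : realType) (x s : R) : 0 <= x -> 0 <= s ->
  0 <= 1 - expR (- (s * x)) <= (1 + x) * (s / (1 + s)).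
Proof.
move=> x0 s0; have p : 0 < 1 + s by lra.
have sx : 0 <= s * x by rewrite mulr_ge0.
apply/andP; split; first by rewrite subr_ge0 -[leRHS]expR0 ler_expR oppr_le0.
rewrite mulrA ler_pdivlMr //.
have := expR_ge1Dx (- (s * x)); have := expR_ge0 (- (s * x)); nra.
Qed.

(** * Integrals against the Levy measure *)

Lemma integrable_levy (R : realType) (a b : R) (mu : {measure set R -> \bar R}) :
  bernstein_data a b mu ->
  mu.-integrable `]0, +oo[ (EFin \o (fun s : R => s / (1 + s))).
Proof.
move=> [_ [_ fin]]; apply/integrableP; split.
  apply/measurable_EFinP; apply: open_continuous_measurable_fun.
    exact: interval_open.
  move=> s; rewrite inE/= in_itv/= andbT => s0.
  apply: cvgM; first exact: cvg_id.
  apply: cvgV; first by rewrite gt_eqF // addr_gt0.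
  by apply: cvgD; [exact: cvg_cst | exact: cvg_id].
apply: le_lt_trans fin; rewrite (eq_integral (fun s : R => (s / (1 + s))%:E)) // => s.
rewrite inE/= in_itv/= andbT => s0.
by rewrite ger0_norm // divr_ge0 ?addr_ge0 ?(ltW s0).
Qed.

Lemma integrable_of_le (R : realType) (a b C : R) (mu : {measure set R -> \bar R}) (f : R -> R) :
  bernstein_data a b mu -> continuous f ->
  (forall s, 0 < s -> `|f s| <= C * (s / (1 + s))) ->
  mu.-integrable `]0, +oo[ (EFin \o f).
Proof.
move=> hmu cf fC; have := integrable_levy hmu.
move=> /(integrableZl (measurable_itv _) C); apply: le_integrable => //.
  apply/measurable_EFinP; apply: measurable_funTS; exact: continuous_measurable_fun.
move=> s /=; rewrite in_itv/= andbT => s0.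
by rewrite lee_fin (le_trans (fC s s0)) // ler_norm.
Qed.

Lemma continuous_cis_kernel (R : realType) (theta x y : R) :
  continuous (cis_kernel theta x y).
Proof.
have cM (c : R) : continuous (fun s : R => s * c).
  by move=> s; apply: continuousM; [exact: cvg_id | exact: cvg_cst].
have ce : continuous (expR \o (fun s => - (s * x))).
  by move=> s; apply: continuous_comp; [apply/continuousN/cM | exact: continuous_expR].
have cc : continuous (cos \o (fun s => s * y + theta)).
  move=> s; apply: continuous_comp; last exact: continuous_cos.
  by apply: continuousD; [exact: cM | exact: cvg_cst].
have -> : cis_kernel theta x y = cst (cos theta) -
  (expR \o (fun s => - (s * x))) * (cos \o (fun s => s * y + theta)) by [].
by move=> s; apply: continuousB; [exact: cvg_cst | apply: continuousM; [exact: ce | exact: cc]].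
Qed.

Lemma integrable_cis_kernel (R : realType) (a b theta x y : R)
    (mu : {measure set R -> \bar R}) :
  bernstein_data a b mu -> 0 <= x ->
  mu.-integrable `]0, +oo[ (EFin \o cis_kernel theta x y).
Proof.
move=> hmu x0; set r := Num.sqrt (x ^+ 2 + y ^+ 2).
apply: (integrable_of_le (C := 4 * (1 + r)) hmu); first exact: continuous_cis_kernel.
move=> s s0; rewrite (le_trans (norm_cis_kernel_le theta y x0 (ltW s0))) // -mulrA ler_wpM2l //.
by have /andP[] := one_sub_expR_le (sqrtr_ge0 _ : 0 <= r) (ltW s0).
Qed.

Lemma integrable_one_sub_expR (R : realType) (a b x : R) (mu : {measure set R -> \bar R}) :
  bernstein_data a b mu -> 0 <= x ->
  mu.-integrable `]0, +oo[ (EFin \o (fun s : R => 1 - expR (- (s * x)))).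
Proof.
move=> hmu x0; have := integrable_cis_kernel 0 0 hmu x0; apply: eq_integrable => // s _ /=.
by rewrite /cis_kernel mulr0 add0r cos0 mulr1.
Qed.

Lemma bern_reE (R : realType) (a b x y : R) (mu : {measure set R -> \bar R}) :
  bern_re a b mu x y = a + b * x + Rintegral mu `]0, +oo[ (cis_kernel 0 x y).
Proof.
rewrite /bern_re; congr (_ + _); apply: eq_Rintegral => s _.
by rewrite /cis_kernel cos0 addr0.
Qed.

Lemma bern_imE (R : realType) (a b x y : R) (mu : {measure set R -> \bar R}) :
  bern_im a b mu x y = b * y + Rintegral mu `]0, +oo[ (cis_kernel (pi / 2) x y).
Proof.
rewrite /bern_im; congr (_ + _); apply: eq_Rintegral => s _.
by rewrite /cis_kernel cos_pihalf cosDpihalf mulrN sub0r opprK.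
Qed.

Lemma bern_re_real (R : realType) (a b x : R) (mu : {measure set R -> \bar R}) :
  bern_re a b mu x 0 =
  a + b * x + Rintegral mu `]0, +oo[ (fun s => 1 - expR (- (s * x))).
Proof.
rewrite /bern_re; congr (_ + _); apply: eq_Rintegral => s _.
by rewrite mulr0 cos0 mulr1.
Qed.

(** * The upper bound for an arbitrary Bernstein function *)

Lemma norm_Rintegral_cis_kernel_le (R : realType) (a b theta x y : R)
    (mu : {measure set R -> \bar R}) : bernstein_data a b mu -> 0 <= x ->
  `|Rintegral mu `]0, +oo[ (cis_kernel theta x y)| <=
  4 * Rintegral mu `]0, +oo[ (fun s => 1 - expR (- (s * Num.sqrt (x ^+ 2 + y ^+ 2)))).
Proof.
move=> hmu x0; set r := Num.sqrt _.
have i1 := integrable_cis_kernel theta y hmu x0.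
have i2 := integrable_one_sub_expR hmu (sqrtr_ge0 _ : 0 <= r).
rewrite (le_trans (le_normr_Rintegral _ i1)) // -RintegralZl //.
apply: le_Rintegral => //.
- exact: (integrable_abse i1).
- exact: (integrableZl _ 4 i2).
- move=> s /=; rewrite in_itv/= andbT => s0; exact: norm_cis_kernel_le (ltW s0).
Qed.

Lemma bern_abs_le (R : realType) (a b x y : R) (mu : {measure set R -> \bar R}) :
  bernstein_data a b mu -> 0 <= x ->
  bern_abs a b mu x y <= 3 * expR 1 * bern_re a b mu (Num.sqrt (x ^+ 2 + y ^+ 2)) 0.
Proof.
move=> hmu x0; have [a0 [b0 _]] := hmu; rewrite bern_re_real /bern_abs.
have kle theta := norm_Rintegral_cis_kernel_le theta y hmu x0.
have xr : x <= Num.sqrt (x ^+ 2 + y ^+ 2).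
  by rewrite -{1}(ger0_norm x0) -sqrtr_sqr ler_wsqrtr // lerDl sqr_ge0.
have yr : `|y| <= Num.sqrt (x ^+ 2 + y ^+ 2).
  by rewrite -sqrtr_sqr ler_wsqrtr // lerDr sqr_ge0.
set r := Num.sqrt (x ^+ 2 + y ^+ 2) in kle xr yr *.
set I := Rintegral _ _ _ in kle *; set g := a + b * r + I.
have I0 : 0 <= I by have := le_trans (normr_ge0 _) (kle 0); rewrite pmulr_rge0.
have r0 : 0 <= r := sqrtr_ge0 _.
have br : 0 <= b * r by rewrite mulr_ge0.
have bxr : b * x <= b * r by rewrite ler_wpM2l.
have byr : `|b * y| <= b * r by rewrite normrM ger0_norm // ler_wpM2l.
have bx : 0 <= b * x by rewrite mulr_ge0.
have re_le : `|bern_re a b mu x y| <= 4 * g.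
  rewrite bern_reE (le_trans (ler_normD _ _)) // ger0_norm ?addr_ge0 //.
  have := kle 0; rewrite /g; lra.
have im_le : `|bern_im a b mu x y| <= 4 * g.
  rewrite bern_imE (le_trans (ler_normD _ _)) //.
  have := kle (pi / 2); rewrite /g; lra.
have g0 : 0 <= g by rewrite !addr_ge0.
have e2 : 2 <= expR 1 :> R by have := expR_ge1Dx (1 : R); lra.
(* Both parts are at most 4 g, so the modulus is at most sqrt(32) g <= 6 g, and 6 <= 3e already
   follows from e >= 2. *)
have eg : 6 * g <= 3 * expR 1 * g by rewrite ler_wpM2r //; lra.
apply: le_trans eg; rewrite -[leRHS]ger0_norm ?mulr_ge0 // -sqrtr_sqr ler_wsqrtr //.
move: re_le im_le; rewrite !ler_norml => /andP[h1 h2] /andP[h3 h4]; nra.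
Qed.

(** * Power series expansion of a Bernstein function about a real point *)

Lemma Rintegral_sum (R : realType) (mu : {measure set R -> \bar R}) (D : set R)
    (n : nat) (f : nat -> R -> R) : measurable D ->
  (forall k, mu.-integrable D (EFin \o f k)) ->
  mu.-integrable D (EFin \o (fun s => \sum_(k < n) f k s)) /\
  Rintegral mu D (fun s => \sum_(k < n) f k s) = \sum_(k < n) Rintegral mu D (f k).
Proof.
move=> mD fi; elim: n => [|n [IH1 IH2]].
  have -> : (fun s => \sum_(k < 0) f k s) = cst 0 by apply/funext => s; rewrite big_ord0.
  by rewrite big_ord0 /Rintegral integral0; split => //; exact: integrable0.
have e s : \sum_(k < n.+1) f k s = \sum_(k < n) f k s + f n s by rewrite big_ord_recr.
have -> : (fun s => \sum_(k < n.+1) f k s) = (fun s => \sum_(k < n) f k s + f n s).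
  by apply/funext => s.
split; first exact: (integrableD mD IH1 (fi n)).
by rewrite RintegralD // IH2 big_ord_recr.
Qed.

(** Up to the sign (-1)^k, the k-th Taylor coefficient at [c] of z |-> 1 - e^{-sz}; the indicator of
    k = 0 carries the constant 1. *)
Definition levy_coef (R : realType) (c : R) (k : nat) (s : R) : R :=
  (k == 0%N)%:R - expR (- (s * c)) * (s ^+ k / k`!%:R).

Lemma continuous_levy_coef (R : realType) (c : R) (k : nat) : continuous (levy_coef c k).
Proof.
have ce : continuous (expR \o (fun s => - (s * c))).
  move=> s; apply: continuous_comp; last exact: continuous_expR.
  by apply: continuousN; apply: continuousM; [exact: cvg_id | exact: cvg_cst].
have -> : levy_coef c k = cst (k == 0%N)%:R -
  (expR \o (fun s => - (s * c))) * ((@GRing.exp R ^~ k) * cst (k`!%:R^-1)) by [].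
move=> s; apply: continuousB; first exact: cvg_cst.
apply: continuousM; first exact: ce.
by apply: continuousM; [exact: exprn_continuous | exact: cvg_cst].
Qed.

Lemma expR_exp_rem_le (R : realType) (c rho s : R) (N : nat) : 0 <= rho <= c -> 0 <= s ->
  expR (- (s * c)) * exp_rem N.+1 (s * rho) <= 1 - expR (- (s * c)).
Proof.
move=> /andP[r0 rc] s0.
have h : expR (- (s * c)) * expR (s * rho) <= 1.
  rewrite -expRD -[leRHS]expR0 ler_expR addrC subr_le0 ler_wpM2l //.
have := ler_wpM2l (expR_ge0 (- (s * c))) (exp_rem_le N (mulr_ge0 s0 r0)); lra.
Qed.

(** The term k = 0 contributes 1 - e^{-sc}. The others sum to at most e^{-sc} (e^{s rho} - 1), which
    is at most 1 - e^{-sc} since rho <= c. The bound is uniform in N. *)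
Lemma sum_levy_coef_le (R : realType) (c rho s : R) (N : nat) : 0 <= rho <= c -> 0 <= s ->
  \sum_(k < N.+1) `|levy_coef c k s| * rho ^+ k <= 2 * (1 - expR (- (s * c))).
Proof.
move=> /[dup] hr /andP[r0 rc] s0; have c0 := le_trans r0 rc.
rewrite big_ord_recl /levy_coef /= expr0 !mulr1 divr1 mulr1 ger0_norm; last first.
  by rewrite subr_ge0 -[leRHS]expR0 ler_expR oppr_le0 mulr_ge0.
rewrite mulr_natl mulr2n lerD2l.
apply: le_trans (expR_exp_rem_le 0 hr s0).
have := exp_rem_ge0 N.+1 (mulr_ge0 s0 r0); rewrite /exp_rem /egf_sum big_ord1.
rewrite big_ord_recl /= expr0 divr1 mulr1 => h.
have -> : \sum_(i < N) `|(bump 0 i == 0%N)%:R -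
     expR (- (s * c)) * (s ^+ bump 0 i / (bump 0 i)`!%:R)| * rho ^+ bump 0 i =
   expR (- (s * c)) * \sum_(i < N) 1 * ((s * rho) ^+ bump 0 i / (bump 0 i)`!%:R).
  rewrite mulr_sumr; apply: eq_bigr => i _; rewrite /bump /= add1n sub0r normrN.
  by rewrite ger0_norm ?mulr_ge0 ?expR_ge0 ?divr_ge0 ?exprn_ge0 // exprMn; ring.
by rewrite ler_wpM2l ?expR_ge0 //; lra.
Qed.

Lemma integrable_levy_coef (R : realType) (a b c : R) (k : nat)
    (mu : {measure set R -> \bar R}) : bernstein_data a b mu -> 0 < c ->
  mu.-integrable `]0, +oo[ (EFin \o levy_coef c k).
Proof.
move=> hmu c0; apply: (integrable_of_le (C := 2 * (1 + c) / c ^+ k) hmu).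
  exact: continuous_levy_coef.
move=> s s0; have ck : 0 < c ^+ k by rewrite exprn_gt0.
rewrite mulrAC ler_pdivlMr //.
(* A single coefficient is isolated from the weighted sum at rho = c, which explains the factor c^k
   in the constant. *)
have := @sum_levy_coef_le R c c s k; rewrite (ltW c0) lexx (ltW s0) => /(_ isT isT) h.
have /andP[_ h2] := one_sub_expR_le (ltW c0) (ltW s0).
have h3 : `|levy_coef c k s| * c ^+ k <= \sum_(i < k.+1) `|levy_coef c i s| * c ^+ i.
  rewrite big_ord_recr lerDr /=; apply: sumr_ge0 => i _.
  by rewrite mulr_ge0 // exprn_ge0 // ltW.
lra.
Qed.

(** The point is c + w with w = - r e^{-i beta}. The signs of w^k and of the Taylor coefficient
    cancel, leaving r^k cos(theta + k beta). *)
Lemma cis_kernel_taylor (R : realType) (c r theta beta s : R) (N : nat) :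
  cis_kernel theta (c - r * cos beta) (r * sin beta) s =
  \sum_(k < N.+1) r ^+ k * cos (theta + k%:R * beta) * levy_coef c k s
  - expR (- (s * c)) * cis_rem theta beta N.+1 (s * r).
Proof.
under eq_bigr do rewrite /levy_coef mulrBr.
rewrite sumrB big_ord_recl /= expr0 mul1r mul0r addr0 mulr1 big1 ?addr0; last first.
  by move=> k _; rewrite mulr0.
have -> : \sum_(k < N.+1) r ^+ k * cos (theta + k%:R * beta) *
    (expR (- (s * c)) * (s ^+ k / k`!%:R)) =
    expR (- (s * c)) * egf_sum (fun k => cos (theta + k%:R * beta)) N.+1 (s * r).
  rewrite mulr_sumr; apply: eq_bigr => k _; rewrite exprMn; ring.
have e : expR (- (s * (c - r * cos beta))) = expR (- (s * c)) * expR (s * r * cos beta).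
  by rewrite -expRD; congr expR; ring.
rewrite /cis_kernel /cis_rem e !mulrA; ring.
Qed.

Lemma Rintegral_cis_kernel_taylor (R : realType) (a b c r rho theta beta : R) (N : nat)
    (mu : {measure set R -> \bar R}) :
  bernstein_data a b mu -> 0 < rho < c -> 0 <= r <= rho -> 0 <= c - r * cos beta ->
  `|Rintegral mu `]0, +oo[ (cis_kernel theta (c - r * cos beta) (r * sin beta)) -
    \sum_(k < N.+1) r ^+ k * cos (theta + k%:R * beta) *
       Rintegral mu `]0, +oo[ (levy_coef c k)| <=
  (r / rho) ^+ N.+1 * Rintegral mu `]0, +oo[ (fun s => 1 - expR (- (s * c))).
Proof.
move=> hmu /andP[rho0 rhoc] /andP[r0 rrho] c0; have cp := lt_trans rho0 rhoc.
have i1 := integrable_cis_kernel theta (r * sin beta) hmu c0.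
have hi k : mu.-integrable `]0, +oo[ (EFin \o levy_coef c k).
  exact: integrable_levy_coef hmu cp.
have mD : measurable (`]0, +oo[ : set R) by exact: measurable_itv.
pose F k s := r ^+ k * cos (theta + k%:R * beta) * levy_coef c k s.
have Fi k : mu.-integrable `]0, +oo[ (EFin \o F k) by exact: (integrableZl mD _ (hi k)).
have [Si SE] := Rintegral_sum N.+1 mD Fi.
have <- : Rintegral mu `]0, +oo[ (fun s => \sum_(k < N.+1) F k s) =
   \sum_(k < N.+1) r ^+ k * cos (theta + k%:R * beta) *
       Rintegral mu `]0, +oo[ (levy_coef c k).
  by rewrite SE; apply: eq_bigr => k _; rewrite RintegralZl.
have i2 := integrable_one_sub_expR hmu (ltW cp).
rewrite -RintegralB // -RintegralZl //.
have iB := integrableB mD i1 Si.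
rewrite (le_trans (le_normr_Rintegral mD iB)) //; apply: le_Rintegral => //.
- exact: (integrable_abse iB).
- exact: (integrableZl mD _ i2).
move=> s /=; rewrite in_itv/= andbT => /ltW s0.
rewrite (cis_kernel_taylor _ _ _ _ _ N) addrAC subrr add0r normrN normrM.
rewrite ger0_norm ?expR_ge0 //.
have q01 : 0 <= r / rho <= 1.
  by rewrite divr_ge0 ?(ltW rho0) //= ler_pdivrMr // mul1r.
have := norm_cis_rem_le theta beta N.+1 (mulr_ge0 s0 r0).
(* Comparing radius r with the larger rho extracts the factor (r / rho)^(N+1), and the remainder at
   rho is still dominated by 1 - e^{-sc}. *)
have -> : s * r = r / rho * (s * rho) by field; rewrite gt_eqF.
move=> h; have {}h := le_trans h (exp_rem_scale N.+1 q01 (mulr_ge0 s0 (ltW rho0))).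
have {}h := ler_wpM2l (expR_ge0 (- (s * c))) h; apply: le_trans h _.
rewrite mulrCA ler_wpM2l ?exprn_ge0 ?divr_ge0 ?(ltW rho0) //.
by apply: expR_exp_rem_le; rewrite ?(ltW rho0) ?(ltW rhoc).
Qed.

Definition bern_int (R : realType) (mu : {measure set R -> \bar R}) (z : R[i]) : R[i] :=
  Rintegral mu `]0, +oo[ (cis_kernel 0 (complex.Re z) (complex.Im z)) +i*
  Rintegral mu `]0, +oo[ (cis_kernel (pi / 2) (complex.Re z) (complex.Im z)).

(** De Moivre's formula, with - sin written as a cosine shifted by pi / 2 so that both components
    match the kernels for theta = 0 and theta = pi / 2. *)
Lemma expc_polar (R : realType) (r beta : R) (k : nat) :
  ((r * cos beta) +i* (- (r * sin beta))) ^+ k =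
  (r ^+ k * cos (0 + k%:R * beta)) +i* (r ^+ k * cos (pi / 2 + k%:R * beta)).
Proof.
elim: k => [|k IH].
  by rewrite expr0 mul0r !addr0 cos0 cos_pihalf mulr1 mulr0.
have e t : t + k.+1%:R * beta = t + k%:R * beta + beta by rewrite mulrSr; ring.
rewrite exprSr IH !e !add0r [pi / 2 + _]addrC -[_ + pi / 2 + beta]addrA.
rewrite [pi / 2 + beta]addrC addrA !cosDpihalf cosD sinD.
apply/eqP; rewrite eq_complex /=; apply/andP; split; apply/eqP; rewrite exprSr; ring.
Qed.

Lemma normc_le (R : rcfType) (x y m : R) : `|x| <= m -> `|y| <= m ->
  `|x +i* y : R[i]| <= (2 * m)%:C.
Proof.
move=> hx hy; have m0 := le_trans (normr_ge0 _) hx.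
rewrite normc_def /= lecR -[leRHS]ger0_norm ?mulr_ge0 // -sqrtr_sqr ler_wsqrtr //.
by move: hx hy; rewrite !ler_norml => /andP[h1 h2] /andP[h3 h4]; nra.
Qed.

Lemma bern_int_taylor (R : realType) (a b c rho : R) (mu : {measure set R -> \bar R}) :
  bernstein_data a b mu -> 0 < rho < c ->
  taylor_approx rho%:C (fun w => bern_int mu (c%:C + w)).
Proof.
move=> hmu /[dup] hrho /andP[rho0 rhoc]; have cp := lt_trans rho0 rhoc.
set I := Rintegral mu `]0, +oo[ (fun s => 1 - expR (- (s * c))).
have I0 : 0 <= I.
  apply: Rintegral_ge0 => s /=; rewrite in_itv/= andbT => /ltW s0.
  by have /andP[] := one_sub_expR_le (ltW cp) s0.
have mD : measurable (`]0, +oo[ : set R) by exact: measurable_itv.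
have hi k : mu.-integrable `]0, +oo[ (EFin \o levy_coef c k).
  exact: integrable_levy_coef hmu cp.
pose C k := Rintegral mu `]0, +oo[ (levy_coef c k).
(* The same constant serves twice: [sum_levy_coef_le] has the factor 2 for the norm of the
   coefficients, and [normc_le] loses 2 when the two component errors are combined. *)
exists (2 * I)%:C => [|N]; first by rewrite ler0c mulr_ge0.
have sz : (size (\poly_(k < N.+1) ((-1) ^+ k * C k)%:C) <= N.+1)%N by exact: size_poly.
exists (\poly_(k < N.+1) ((-1) ^+ k * C k)%:C); split => //.
  rewrite (l1norm_wide _ sz).
  have -> : \sum_(i < N.+1) `|(\poly_(k < N.+1) ((-1) ^+ k * C k)%:C)`_i| * rho%:C ^+ i
     = (\sum_(i < N.+1) `|C i| * rho ^+ i)%:C.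
    rewrite rmorph_sum /=; apply: eq_bigr => i _; rewrite coef_poly ltn_ord.
    rewrite [RHS]rmorphM [X in _ = _ * X]rmorphXn normc_def /= expr0n addr0 sqrtr_sqr normrM normrX normrN1.
    by rewrite expr1n mul1r.
  rewrite lecR.
  pose F k s := rho ^+ k * `|levy_coef c k s|.
  have Fi k : mu.-integrable `]0, +oo[ (EFin \o F k).
    exact: (integrableZl mD _ (integrable_abse (hi k))).
  have [Si SE] := Rintegral_sum N.+1 mD Fi.
  apply: (@le_trans _ _ (Rintegral mu `]0, +oo[ (fun s => \sum_(k < N.+1) F k s))).
    rewrite SE; apply: ler_sum => k _; rewrite RintegralZl //.
      by rewrite mulrC ler_wpM2l ?exprn_ge0 ?(ltW rho0) // (le_normr_Rintegral mD (hi k)).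
    exact: (integrable_abse (hi k)).
  rewrite -RintegralZl //; last exact: integrable_one_sub_expR hmu (ltW cp).
  apply: le_Rintegral => //.
    exact: (integrableZl mD _ (integrable_one_sub_expR hmu (ltW cp))).
  move=> s /=; rewrite in_itv/= andbT => /ltW s0.
  under eq_bigr do rewrite /F mulrC.
  by apply: sum_levy_coef_le; rewrite ?(ltW rho0) ?(ltW rhoc).
move=> [u v]; rewrite normc_def /= lecR.
have [beta []] := polar_coordinates u v; set r := Num.sqrt _ => uE vE rrho.
have r0 : 0 <= r := sqrtr_ge0 _.
have ur : - u <= r.
  rewrite (le_trans (ler_norm _)) // normrN -sqrtr_sqr ler_wsqrtr // lerDl sqr_ge0 //.
(* The disc stays in the right half-plane: Re w >= - r >= - rho > - c. *)
have c0 : 0 <= c - r * cos beta by rewrite -uE; lra.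
have key theta := Rintegral_cis_kernel_taylor theta N hmu hrho (introT andP (conj r0 rrho)) c0.
have -> : (2 * I)%:C * (r%:C / rho%:C) ^+ N.+1 = (2 * ((r / rho) ^+ N.+1 * I))%:C.
  by rewrite -fmorphV -rmorphM -rmorphXn -rmorphM /= -mulrA [I * _]mulrC.
have -> : (\poly_(k < N.+1) ((-1) ^+ k * C k)%:C).[u +i* v] =
   (\sum_(k < N.+1) r ^+ k * cos (0 + k%:R * beta) * C k) +i*
   (\sum_(k < N.+1) r ^+ k * cos (pi / 2 + k%:R * beta) * C k).
  rewrite horner_poly.
  have E k : ((-1) ^+ k * C k)%:C * (u +i* v) ^+ k =
      (r ^+ k * cos (0 + k%:R * beta) * C k) +i* (r ^+ k * cos (pi / 2 + k%:R * beta) * C k).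
    (* The minus sign of the polar form yields a second (-1)^k, cancelling the one in the
       coefficients. *)
    have -> : u +i* v = - ((r * cos beta) +i* (- (r * sin beta))).
      by apply/eqP; rewrite eq_complex /= -uE opprK -vE !eqxx.
    rewrite [(- (_ +i* _)) ^+ k]exprNn expc_polar rmorphM rmorphXn rmorphN1 mulrACA -expr2 -exprM mulnC exprM.
    rewrite sqrrN expr1n expr1n mul1r.
    by apply/eqP; rewrite eq_complex /= !mul0r subr0 addr0 ![C k * _]mulrC !eqxx.
  under eq_bigr do rewrite E.
  by elim/big_rec3: _ => // i x y z _ ->.
have -> : bern_int mu (c%:C + u +i* v) - ((\sum_(k < N.+1) r ^+ k * cos (0 + k%:R * beta) * C k) +i*
   (\sum_(k < N.+1) r ^+ k * cos (pi / 2 + k%:R * beta) * C k)) =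
  (Rintegral mu `]0, +oo[ (cis_kernel 0 (c - r * cos beta) (r * sin beta)) -
     \sum_(k < N.+1) r ^+ k * cos (0 + k%:R * beta) * C k) +i*
  (Rintegral mu `]0, +oo[ (cis_kernel (pi / 2) (c - r * cos beta) (r * sin beta)) -
     \sum_(k < N.+1) r ^+ k * cos (pi / 2 + k%:R * beta) * C k).
  by rewrite /bern_int /= add0r -uE -vE.
exact: normc_le (key 0) (key (pi / 2)).
Qed.

Definition bernc (R : realType) (a b : R) (mu : {measure set R -> \bar R}) (z : R[i]) : R[i] :=
  bern_re a b mu (complex.Re z) (complex.Im z) +i* bern_im a b mu (complex.Re z) (complex.Im z).

Lemma berncE (R : realType) (a b : R) (mu : {measure set R -> \bar R}) (z : R[i]) :
  bernc a b mu z = a%:C + b%:C * z + bern_int mu z.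
Proof.
case: z => x y; rewrite /bernc /bern_int bern_reE bern_imE.
by apply/eqP; rewrite eq_complex /= !mul0r subr0 add0r addr0 !eqxx.
Qed.

Lemma bernc_taylor (R : realType) (a b c rho : R) (mu : {measure set R -> \bar R}) :
  bernstein_data a b mu -> 0 < rho < c ->
  taylor_approx rho%:C (fun w => bernc a b mu (c%:C + w)).
Proof.
move=> hmu /[dup] hrho /andP[rho0 rhoc].
have rho0' : 0 < rho%:C by rewrite ltcR.
have -> : (fun w => bernc a b mu (c%:C + w)) =
    (fun w => (a%:C + b%:C * c%:C + b%:C * w) + bern_int mu (c%:C + w)).
  by apply/funext => w; rewrite berncE mulrDr addrA.
apply: taylor_approxD; [exact: ltW | exact: taylor_approx_linear | exact: (bern_int_taylor hmu)].
Qed.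

(** * The identity g(z) f(z) = z off the real axis *)

Lemma bern_im_real (R : realType) (a b x : R) (mu : {measure set R -> \bar R}) :
  bern_im a b mu x 0 = 0.
Proof.
rewrite /bern_im mulr0 add0r /Rintegral integral0_eq // => s _.
by rewrite mulr0 sin0 mulr0.
Qed.

Lemma le_geometric_eq0 (R : realType) (h m q : R) : 0 <= h -> 0 <= q < 1 ->
  (forall N, h <= m * q ^+ N.+1) -> h = 0.
Proof.
move=> h0 /andP[q0 q1] hle; apply/eqP; rewrite eq_le h0 andbT.
have nq : `|q| < 1 by rewrite ger0_norm.
apply: (cvgr_to_ge (cvg_geometric (m * q) nq)).
by apply: nearW => N; rewrite /geometric /= -mulrA -exprS.
Qed.

(* The disc about [c = |z|^2 / x] through the origin contains [z]. *)
Lemma bernc_mul_eq (R : realType) (a b a' b' : R) (mu nu : {measure set R -> \bar R}) :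
  bernstein_data a b mu -> bernstein_data a' b' nu ->
  (forall x, 0 < x -> bern_re a b mu x 0 * bern_re a' b' nu x 0 = x) ->
  forall z : R[i], 0 < complex.Re z -> bernc a b mu z * bernc a' b' nu z = z.
Proof.
move=> hmu hnu hreal z x0; set x := complex.Re z in x0; pose y := complex.Im z.
pose n2 := x ^+ 2 + y ^+ 2; pose c := n2 / x.
have n20 : 0 < n2 by rewrite ltr_wpDr ?sqr_ge0 // exprn_gt0.
have c0 : 0 < c by rewrite divr_gt0.
pose r := Num.sqrt ((x - c) ^+ 2 + y ^+ 2).
have r0 : 0 <= r := sqrtr_ge0 _.
(* As x c = |z|^2, the squared distance from [z] to [c] is c^2 - |z|^2. *)
have rc : r < c.
  rewrite -ltr_sqr ?nnegrE ?(ltW c0) // sqr_sqrtr ?addr_ge0 ?sqr_ge0 //.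
  have : x * c = n2 by rewrite /c; field; rewrite gt_eqF.
  rewrite -subr_gt0 /n2; nra.
(* An intermediate radius: rho < c makes the expansions available, and r < rho makes the error decay
   geometrically at [z]. *)
pose rho := (r + c) / 2.
have hrho : 0 < rho < c by rewrite /rho; apply/andP; split; lra.
have rrho : r < rho by rewrite /rho; lra.
have rho0 : 0 < rho by case/andP: hrho.
have rho0' : 0 < rho%:C by rewrite ltcR.
pose H w := bernc a b mu (c%:C + w) * bernc a' b' nu (c%:C + w) + - (c%:C + 1 * w).
have Ha : taylor_approx rho%:C H.
  apply: taylor_approxD; first exact: ltW.
    by apply: taylor_approxM => //; [exact: (bernc_taylor hmu) | exact: (bernc_taylor hnu)].
  by apply: taylor_approxN; exact: taylor_approx_linear.
have [|M M0 hM] := taylor_approx_eq0 rho0' Ha.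
  (* In the order of [R[i]], 0 < t forces [t] to be real, so only the identity on the positive axis
     is called upon. *)
  move=> t /andP[t0 _]; have /complex_realP[k kE] : t \is Num.real by rewrite gtr0_real.
  have k0 : 0 < k by rewrite -ltcR -kE.
  rewrite /H kE /bernc /= addr0 !bern_im_real mul1r.
  apply/eqP; rewrite eq_complex /= !mulr0 !mul0r subr0 !addr0 hreal ?addr_gt0 //.
  by rewrite !subrr !eqxx.
have w0E : `|z - c%:C| = r%:C.
  by rewrite normc_def /r /y /x; case: (z) => u v /=; rewrite subr0.
(* The bound comes as a nonnegative element of [R[i]]; it is replaced by its real part so that the
   limit in N is taken in [R]. *)
have M1 : M \is Num.real by rewrite ger0_real.
move: M0 hM; rewrite -(RRe_real M1); set m := complex.Re M => m0 hM.
suff h0 : `|H (z - c%:C)| = 0.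
  have cz : c%:C + (z - c%:C) = z by rewrite addrC subrK.
  by move/eqP: h0; rewrite normr_eq0 /H mul1r cz subr_eq0 => /eqP.
rewrite normc_def; set h := Num.sqrt _.
have hle N : h <= m * (r / rho) ^+ N.+1.
  have := hM N (z - c%:C); rewrite w0E lecR (ltW rrho) => /(_ isT).
  by rewrite normc_def -fmorphV -rmorphM -rmorphXn -rmorphM lecR.
have h_ge0 : 0 <= h := sqrtr_ge0 _.
suff -> : h = 0 by [].
apply: (le_geometric_eq0 h_ge0 _ hle).
by rewrite divr_ge0 ?(ltW rho0) //= ltr_pdivrMr // mul1r.
Qed.

(** * Monotonicity and positivity on the positive axis *)

Lemma le_bern_re (R : realType) (a b x y : R) (mu : {measure set R -> \bar R}) :
  bernstein_data a b mu -> 0 <= x <= y -> bern_re a b mu x 0 <= bern_re a b mu y 0.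
Proof.
move=> hmu /andP[x0 xy]; have [a0 [b0 _]] := hmu; have y0 := le_trans x0 xy.
rewrite !bern_re_real -!addrA lerD2l lerD ?ler_wpM2l //; apply: le_Rintegral => //.
- exact: integrable_one_sub_expR hmu x0.
- exact: integrable_one_sub_expR hmu y0.
move=> s /=; rewrite in_itv/= andbT => /ltW s0.
by rewrite lerD2l lerN2 ler_expR lerN2 ler_wpM2l.
Qed.

(** Under the integral this is Bernoulli's inequality 1 - q^n <= n (1 - q) with q = e^{-sx} in
    [0, 1]. *)
Lemma bern_re_natmul_le (R : realType) (a b x : R) (n : nat) (mu : {measure set R -> \bar R}) :
  bernstein_data a b mu -> 0 <= x ->
  bern_re a b mu (n.+1%:R * x) 0 <= n.+1%:R * bern_re a b mu x 0.
Proof.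
move=> hmu x0; have [a0 [b0 _]] := hmu.
have n1 : 1 <= n.+1%:R :> R by rewrite ler1n.
have nx0 : 0 <= n.+1%:R * x by rewrite mulr_ge0.
have i1 := integrable_one_sub_expR hmu x0.
rewrite !bern_re_real !mulrDr -RintegralZl //.
rewrite lerD //; first by rewrite lerD ?ler_peMl // mulrCA.
apply: le_Rintegral => //.
- exact: integrable_one_sub_expR hmu nx0.
- exact: (integrableZl _ _ i1).
move=> s /=; rewrite in_itv/= andbT => /ltW s0.
have -> : - (s * (n.+1%:R * x)) = n.+1%:R * - (s * x) by ring.
rewrite expRM_natl; set q := expR _.
have q0 : 0 <= q := expR_ge0 _.
have q1 : q <= 1 by rewrite -[leRHS]expR0 ler_expR oppr_le0 mulr_ge0.
elim: (n.+1) => [|m IH]; first by rewrite expr0 subrr mul0r.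
have qm : q ^+ m <= 1 by rewrite exprn_ile1.
have := mulr_ge0 q0 (exprn_ge0 m q0); rewrite exprS mulrSr; nra.
Qed.

(** A nonzero value at u + iv gives g(r) > 0 at r = |u + iv| by the upper bound. With r <= (n+1) x,
    monotonicity gives g(r) <= g((n+1) x) <= (n+1) g(x). This makes x / g(x) a genuine quotient. *)
Lemma bern_re_gt0 (R : realType) (a b x : R) (mu : {measure set R -> \bar R}) :
  bernstein_data a b mu -> bern_nonzero a b mu -> 0 < x -> 0 < bern_re a b mu x 0.
Proof.
move=> hmu [u [v [u0 huv]]] x0; set r := Num.sqrt (u ^+ 2 + v ^+ 2).
have abs_gt0 : 0 < bern_abs a b mu u v.
  rewrite sqrtr_gt0 lt_neqAle addr_ge0 ?sqr_ge0 // andbT eq_sym.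
  rewrite paddr_eq0 ?sqr_ge0 // !sqrf_eq0 negb_and; exact/orP.
have gr : 0 < bern_re a b mu r 0.
  have := lt_le_trans abs_gt0 (bern_abs_le v hmu u0).
  by rewrite pmulr_rgt0 // mulr_gt0 // expR_gt0.
pose n := Num.truncn (r / x).
have rn : r <= n.+1%:R * x by rewrite -ler_pdivrMr // ltW // truncnS_gt.
have := le_trans (le_bern_re hmu (introT andP (conj (sqrtr_ge0 _) rn)))
  (bern_re_natmul_le n hmu (ltW x0)).
by move=> /(lt_le_trans gr); rewrite pmulr_rgt0.
Qed.

Lemma norm_bernc (R : realType) (a b : R) (mu : {measure set R -> \bar R}) (z : R[i]) :
  `|bernc a b mu z| = (bern_abs a b mu (complex.Re z) (complex.Im z))%:C.
Proof. by rewrite normc_def. Qed.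

(** * The reverse inequality in the open half-plane *)

Lemma bern_re_le_interior (R : realType) (a b x y : R) (mu : {measure set R -> \bar R}) :
  bernstein_data a b mu -> bern_nonzero a b mu -> bern_special a b mu -> 0 < x ->
  bern_re a b mu (Num.sqrt (x ^+ 2 + y ^+ 2)) 0 <= 3 * expR 1 * bern_abs a b mu x y.
Proof.
move=> hmu nz [a' [b' [nu [hnu sp]]]] x0; set r := Num.sqrt _.
have rp : 0 < r by rewrite sqrtr_gt0 ltr_wpDr ?sqr_ge0 // exprn_gt0.
have gp t : 0 < t -> 0 < bern_re a b mu t 0 by exact: bern_re_gt0.
have hreal t : 0 < t -> bern_re a b mu t 0 * bern_re a' b' nu t 0 = t.
  by move=> t0; rewrite -sp // mulrC mulfVK // gt_eqF // gp.
have := bernc_mul_eq hmu hnu hreal (z := x +i* y) x0.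
move=> /(congr1 Num.norm); rewrite normrM !norm_bernc normc_def -rmorphM => /complexI /= E.
(* The upper bound for the conjugate function reads |f(z)| <= 3e r / g(r). Multiplied by |g(z)| its
   left side becomes r, which is then cancelled. *)
have := bern_abs_le y hnu (ltW x0); rewrite -/r -sp // => h.
have := ler_wpM2l (sqrtr_ge0 _ : 0 <= bern_abs a b mu x y) h.
rewrite E -/r => {}h; rewrite -(ler_pM2l rp).
move: h; rewrite !mulrA ler_pdivlMr ?gp // => h; apply: le_trans h _.
by rewrite le_eqVlt; apply/orP; left; apply/eqP; ring.
Qed.

(** * Passage to the imaginary axis *)

Lemma cvg_Rintegral_cis_kernel (R : realType) (a b theta y : R)
    (mu : {measure set R -> \bar R}) : bernstein_data a b mu ->
  Rintegral mu `]0, +oo[ (cis_kernel theta (harmonic n) y) @[n --> \oo] -->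
  Rintegral mu `]0, +oo[ (cis_kernel theta 0 y).
Proof.
move=> hmu; have mD : measurable (`]0, +oo[ : set R) by exact: measurable_itv.
have h0 n : 0 <= harmonic n :> R by rewrite invr_ge0.
have h1 n : harmonic n <= 1 :> R by rewrite invf_le1 // ler1n.
(* The abscissas 1 / (n+1) are at most 1, so r bounds the modulus of every point of the sequence and
   gives one dominating function. *)
set r := Num.sqrt (1 + y ^+ 2).
apply: fine_cvg; rewrite fineK; last first.
  exact: (integrable_fin_num mD (integrable_cis_kernel theta y hmu (lexx 0))).
apply: (dominated_cvg mD (g := fun s => (4 * (1 - expR (- (s * r))))%:E)).
- move=> n; apply/measurable_EFinP; apply: measurable_funTS.
  apply: continuous_measurable_fun; exact: continuous_cis_kernel.
- move=> s /= _; apply: cvg_EFin; first exact: nearW.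
  have c : continuous (fun x : R => cis_kernel theta x y s).
    have ce : continuous (expR \o (fun x => - (s * x))).
      move=> x; apply: continuous_comp; last exact: continuous_expR.
      by apply: continuousN; apply: continuousM; [exact: cvg_cst | exact: cvg_id].
    have -> : (fun x : R => cis_kernel theta x y s) = cst (cos theta) -
      (expR \o (fun x => - (s * x))) * cst (cos (s * y + theta)) by [].
    move=> x; apply: continuousB; first exact: cvg_cst.
    by apply: continuousM; [exact: ce | exact: cvg_cst].
  exact: (cvg_comp _ _ cvg_harmonic (c 0)).
- by [].
- exact: (integrableZl mD 4 (integrable_one_sub_expR hmu (sqrtr_ge0 _ : 0 <= r))).
- move=> n s /=; rewrite in_itv/= andbT lee_fin => /ltW s0.
  rewrite (le_trans (norm_cis_kernel_le theta y (h0 n) s0)) // ler_wpM2l //.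
  rewrite lerD2l lerN2 ler_expR lerN2 ler_wpM2l // ler_wsqrtr // lerD2r.
  by rewrite exprn_ile1.
Qed.

Lemma cvg_bern_abs (R : realType) (a b y : R) (mu : {measure set R -> \bar R}) :
  bernstein_data a b mu ->
  bern_abs a b mu (harmonic n) y @[n --> \oo] --> bern_abs a b mu 0 y.
Proof.
move=> hmu; rewrite /bern_abs.
have cre : bern_re a b mu (harmonic n) y @[n --> \oo] --> bern_re a b mu 0 y.
  under eq_fun do rewrite bern_reE; rewrite bern_reE.
  apply: cvgD; last exact: cvg_Rintegral_cis_kernel hmu.
  by apply: cvgD; [exact: cvg_cst | apply: cvgM; [exact: cvg_cst | exact: cvg_harmonic]].
have cim : bern_im a b mu (harmonic n) y @[n --> \oo] --> bern_im a b mu 0 y.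
  under eq_fun do rewrite bern_imE; rewrite bern_imE.
  by apply: cvgD; [exact: cvg_cst | exact: cvg_Rintegral_cis_kernel hmu].
exact: (cvg_comp _ _ (cvgD (cvgM cre cre) (cvgM cim cim)) (@sqrt_continuous R _)).
Qed.

Theorem theorem2p7 (R : realType) (a b : R) (mu : {measure set R -> \bar R}) :
  bernstein_data a b mu -> bern_nonzero a b mu -> bern_special a b mu ->
  forall x y : R, 0 <= x ->
    (3 * expR 1)^-1 * bern_abs a b mu x y
      <= bern_re a b mu (Num.sqrt (x ^+ 2 + y ^+ 2)) 0
      <= 3 * expR 1 * bern_abs a b mu x y.
Proof.
move=> hmu nz sp x y x0; have e0 : 0 < 3 * expR 1 :> R by rewrite mulr_gt0 ?expR_gt0.
rewrite mulrC ler_pdivrMr // [_ * (3 * _)]mulrC bern_abs_le //=.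
have [xp|] := ltP 0 x; first exact: bern_re_le_interior.
move=> x_le0; have {x0 x_le0} -> : x = 0 by apply/eqP; rewrite eq_le x_le0.
have lim : 3 * expR 1 * bern_abs a b mu (harmonic n) y @[n --> \oo] -->
    3 * expR 1 * bern_abs a b mu 0 y.
  by apply: cvgM; [exact: cvg_cst | exact: cvg_bern_abs].
(* By monotonicity g(|iy|) <= g(|1/(n+1) + iy|), so the left side is constant in n and only the
   right side passes to the limit. *)
apply: (cvgr_to_ge lim); apply: nearW => n.
have hn : 0 < harmonic n :> R by rewrite invr_gt0.
apply: le_trans (bern_re_le_interior y hmu nz sp hn); apply: le_bern_re => //.
by rewrite sqrtr_ge0 /= ler_wsqrtr // lerD2r expr0n sqr_ge0.
Qed.
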